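(* Let $\mathcal{P}$ be a finite set of points in $\mathbb{R}^n$, each point $\mathbf{p}_i\in\mathcal{P}$ having a non-negative radius $r_i$, such that $r_s-r_t<\|\mathbf{p}_s-\mathbf{p}_t\|$ for each pair of points with $r_s>r_t$. Suppose that $T=\{\mathbf{p}_j,\mathbf{p}_k,\mathbf{p}_l\}$ is a subset of three affinely independent points from $\mathcal{P}$, ordered so that $r_j\ge r_k\ge r_l$, with $r_j>r_l$, and suppose that the intersection of the three bisectors from $\mathcal{B}=\{B_{j,k},B_{j,l},B_{k,l}\}$ is nonempty. Then there exists a hyperplane $H_T=\{\mathbf{x}\in\mathbb{R}^n:\mathbf{h}_T\cdot\mathbf{x}=d_T\}$ such that for each pair of bisectors in $\mathcal{B}$, their intersection equals the intersection of $H_T$ with either bisector in the pair, and if any one of the bisectors in $\mathcal{B}$ is a hyperplane, it is identical to $H_T$.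
   Context: Norms are Euclidean. For points $\mathbf{p}_s,\mathbf{p}_t$ with radii $r_s,r_t\ge0$, the bisector of the balls $[\mathbf{p}_s,r_s]$ and $[\mathbf{p}_t,r_t]$ (with centers $\mathbf{p}_s,\mathbf{p}_t$ and radii $r_s,r_t$) is $$B_{s,t}=\{\mathbf{x}\in\mathbb{R}^n:\|\mathbf{p}_s-\mathbf{x}\|+r_s=\|\mathbf{p}_t-\mathbf{x}\|+r_t\}.$$ If $r_s=r_t$ it is the hyperplane that bisects, and is orthogonal to, the segment between $\mathbf{p}_s$ and $\mathbf{p}_t$. If $r_s>r_t$ and $r_s-r_t<\|\mathbf{p}_s-\mathbf{p}_t\|$, it is the sheet closest to $\mathbf{p}_s$ of the hyperboloid $\{\mathbf{x}:|\,\|\mathbf{p}_t-\mathbf{x}\|-\|\mathbf{p}_s-\mathbf{x}\|\,|=r_s-r_t\}$.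
   Formalization: When a bisector of a pair is itself the hyperplane H_T (two equal radii), its intersection with H_T is all of H_T, so the stated equality fails for it; the equality is asserted only for each bisector of the pair that differs from H_T. *)

(* Defs.v *)
From mathcomp Require Export all_boot all_order all_algebra.
From mathcomp Require Export boolp classical_sets cardinality reals.
Set Implicit Arguments.
Unset Strict Implicit.
Unset Printing Implicit Defensive.
Import Order.TTheory GRing.Theory Num.Theory.
Local Open Scope classical_set_scope.
Local Open Scope ring_scope.

Definition dotv (R : realType) (n : nat) (u v : 'rV[R]_n) : R :=
  \sum_(i < n) u 0 i * v 0 i.

(* The norm that the library puts on row vectors is the sup norm. *)
Definition enorm (R : realType) (n : nat) (u : 'rV[R]_n) : R :=
  Num.sqrt (dotv u u).

Definition bisector (R : realType) (n : nat)
    (ps : 'rV[R]_n) (rs : R) (pt : 'rV[R]_n) (rt : R) : set 'rV[R]_n :=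
  [set x | enorm (ps - x) + rs = enorm (pt - x) + rt].

(* A hyperplane only when [h != 0]. *)
Definition hyperplane (R : realType) (n : nat) (h : 'rV[R]_n) (d : R) :
    set 'rV[R]_n :=
  [set x | dotv h x = d].

Definition is_hyperplane (R : realType) (n : nat) (A : set 'rV[R]_n) : Prop :=
  exists h d, h != 0 /\ A = hyperplane h d.

Definition affinely_independent (R : realType) (n : nat)
    (s : seq 'rV[R]_n) : bool :=
  free [seq x - head 0 s | x <- behead s].

(* "[A `&` B] is the intersection of [H] with either of [A] and [B]".  A member
   of the pair that is [H] itself is exempt, since its intersection with [H] is
   all of [H]; the other member then satisfies its equation, so that at least
   one of the two equations always holds. *)
Definition inter_by (T : Type) (H A B : set T) : Prop :=
  (A <> H -> A `&` B = H `&` A) /\ (B <> H -> A `&` B = H `&` B).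

(* Main.v *)
Require Import Defs.
From mathcomp Require Import ring lra.
Import Order.TTheory GRing.Theory Num.Theory.
Local Open Scope classical_set_scope.
Local Open Scope ring_scope.

(** Write [e_s] for the distance from [x] to [p_s], and [a = r_j - r_l],
    [b = r_j - r_k], [c = r_k - r_l], so that [a = b + c].  Eliminating the
    distance from the squared equations of two of the bisectors gives
    [c e_j^2 + b e_l^2 - a e_k^2 = a b c], in which the terms [|x|^2] cancel:
    this is [H_T].  On [B_kl] it amounts to [e_j^2 = (e_k - b)^2], and
    the root [e_j = b - e_k] is excluded by [b < |p_j - p_k|] and the triangle
    inequality.  Finally, a bisector with distinct radii contains no line, since
    the norm would be an affine function on it; hence it is not a hyperplane. *)

Section Euclidean.

Set Implicit Arguments.
Unset Strict Implicit.

Variables (R : realType) (n : nat).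
Implicit Types (u v w p ps pt x h : 'rV[R]_n) (a rs rt : R).

Lemma dotvC u v : dotv u v = dotv v u.
Proof. by apply: eq_bigr => i _; rewrite mulrC. Qed.

Lemma dotvDl u v w : dotv (u + v) w = dotv u w + dotv v w.
Proof. by rewrite -big_split; apply: eq_bigr => i _; rewrite mxE mulrDl. Qed.

Lemma dotvZl a u v : dotv (a *: u) v = a * dotv u v.
Proof. by rewrite /dotv mulr_sumr; apply: eq_bigr => i _; rewrite mxE mulrA. Qed.

Lemma dotvNl u v : dotv (- u) v = - dotv u v.
Proof. by rewrite -scaleN1r dotvZl mulN1r. Qed.

Lemma dotvDr u v w : dotv u (v + w) = dotv u v + dotv u w.
Proof. by rewrite dotvC dotvDl !(dotvC u). Qed.

Lemma dotvZr a u v : dotv u (a *: v) = a * dotv u v.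
Proof. by rewrite dotvC dotvZl dotvC. Qed.

Lemma dotvNr u v : dotv u (- v) = - dotv u v.
Proof. by rewrite dotvC dotvNl dotvC. Qed.

Definition dotvE := (dotvDl, dotvDr, dotvZl, dotvZr, dotvNl, dotvNr).

Lemma dotv_ge0 u : 0 <= dotv u u.
Proof. by apply: sumr_ge0 => i _; rewrite -expr2 sqr_ge0. Qed.

Lemma dotv_eq0 u : (dotv u u == 0) = (u == 0).
Proof.
apply/eqP/eqP => [u0 | ->]; last by apply: big1 => i _; rewrite mxE mul0r.
apply/rowP => i; rewrite mxE; apply/eqP; rewrite -sqrf_eq0 expr2.
move/eqP: u0; rewrite psumr_eq0 => [/allP/(_ i)|j _]; last by rewrite -expr2 sqr_ge0.
by rewrite mem_index_enum => /(_ isT).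
Qed.

Lemma enorm_ge0 u : 0 <= enorm u.
Proof. exact: sqrtr_ge0. Qed.

Lemma sqr_enorm u : enorm u ^+ 2 = dotv u u.
Proof. by rewrite sqr_sqrtr // dotv_ge0. Qed.

Lemma enorm_eq0 u : (enorm u == 0) = (u == 0).
Proof. by rewrite -sqrf_eq0 sqr_enorm dotv_eq0. Qed.

Lemma enormN u : enorm (- u) = enorm u.
Proof. by rewrite /enorm dotvNl dotvNr opprK. Qed.

(** Cauchy-Schwarz: the squared norm of [enorm v *: u - enorm u *: v] equals
    [2 |u| |v| (|u| |v| - u.v)], and [|u| |v|] is positive once both vectors are nonzero. *)
Lemma dotv_le_enorm u v : dotv u v <= enorm u * enorm v.
Proof.
have [->|u0] := eqVneq u 0.
  by rewrite -(scale0r (0 : 'rV_n)) dotvZl mul0r mulr_ge0 ?enorm_ge0.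
have [->|v0] := eqVneq v 0.
  by rewrite -(scale0r (0 : 'rV_n)) dotvZr mul0r mulr_ge0 ?enorm_ge0.
have uv0 : 0 < enorm u * enorm v.
  by rewrite mulr_gt0 // lt_neqAle eq_sym enorm_eq0 enorm_ge0 andbT.
have := dotv_ge0 (enorm v *: u - enorm u *: v).
rewrite !dotvE -!sqr_enorm (dotvC v u) => uv.
rewrite -subr_ge0 -(pmulr_rge0 _ uv0); nra.
Qed.

Lemma enorm_triangle u v : enorm (u + v) <= enorm u + enorm v.
Proof.
rewrite -(@ler_pXn2r _ 2) ?nnegrE ?addr_ge0 ?enorm_ge0 //.
rewrite sqr_enorm !dotvE -!sqr_enorm (dotvC v u).
have := dotv_le_enorm u v; nra.
Qed.

Lemma free2P u v : free [:: u; v] ->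
  forall s t : R, s *: u + t *: v = 0 -> s = 0 /\ t = 0.
Proof.
rewrite free_cons span_seq1 seq1_free => /andP[uv v0] s t st0.
have s0 : s = 0.
  apply/eqP; apply: contraNT uv => s0; apply/vlineP; exists (- (s^-1 * t)).
  have /(congr1 ( *:%R s^-1)) := st0.
  rewrite scalerDr !scalerA mulVf // scale1r scaler0 => /eqP.
  by rewrite addr_eq0 scaleNr => /eqP.
split=> //; move/eqP: st0; rewrite s0 scale0r add0r scaler_eq0.
by rewrite (negPf v0) orbF => /eqP.
Qed.

(** The free pair makes the dimension at least two, so that a hyperplane with normal [h] contains a
    line, here in direction [w]. *)
Lemma free2_orthogonal h u v : free [:: u; v] ->
  exists2 w, w != 0 & dotv h w = 0.
Proof.
move=> uv.
have [hv|hv] := eqVneq (dotv h v) 0.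
  exists v => //; apply: contraTneq uv => ->.
  by rewrite free_cons seq1_free eqxx andbF.
exists (dotv h v *: u - dotv h u *: v); last by rewrite !dotvE mulrC subrr.
rewrite -scaleNr; apply: contra_neq hv => /(free2P uv) [] //.
Qed.

Lemma affine_ge0_slope0 (A B : R) : (forall t, 0 <= A + t * B) -> B = 0.
Proof.
move=> AB; apply/eqP; apply: contraT => B0.
by have := AB (- (A + 1) / B); rewrite divfK //; lra.
Qed.

(** The difference of the two squared distances is affine in [t], and the distances differ by the
    nonzero constant [rs - rt], so each is affine in [t]. Being nonnegative it is constant, yet its
    square has leading coefficient [|u| ^ 2]. *)
Lemma line_not_in_bisector ps rs pt rt p u : rs != rt -> u != 0 ->
  ~ (forall t, bisector ps rs pt rt (p + t *: u)).
Proof.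
move=> rst u0 H.
pose g t := enorm (ps - (p + t *: u)).
have [A [B gE]] : exists A B, forall t, g t = A + t * B.
  pose K := 2 * (rs - rt).
  have K0 : K != 0 by rewrite mulf_neq0 ?subr_eq0 ?pnatr_eq0.
  (* These coefficients solve [(g t + (rs - rt)) ^ 2 = |pt - (p + t u)| ^ 2] for [g t]. *)
  exists ((dotv (pt - p) (pt - p) - dotv (ps - p) (ps - p) - (rs - rt) ^+ 2) / K),
    ((2 * dotv (ps - pt) u) / K) => t.
  apply: (mulIf K0); rewrite [RHS]mulrDl -(mulrA t) !divfK // /K.
  have /(_ t) : forall t, enorm (pt - (p + t *: u)) = g t + (rs - rt).
    by move=> s; have := H s; rewrite /bisector /= /g; lra.
  move/(congr1 (fun z => z ^+ 2)); rewrite sqrrD sqr_enorm [g t ^+ 2]sqr_enorm.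
  rewrite !dotvE.
  rewrite (dotvC p pt) (dotvC u pt) (dotvC p ps) (dotvC u ps) (dotvC u p).
  lra.
have B0 : B = 0.
  by apply: (@affine_ge0_slope0 A) => t; rewrite -gE enorm_ge0.
have gc t : g t ^+ 2 = A ^+ 2 by rewrite gE B0 mulr0 addr0.
suff : dotv u u == 0 by rewrite dotv_eq0 (negPf u0).
(* The second difference of [g ^ 2] at these points is [2 |u| ^ 2]. *)
move: (gc 0) (gc 1) (gc (-1)); rewrite !sqr_enorm !dotvE.
by move=> *; apply/eqP; lra.
Qed.

Lemma bisector_not_hyperplane ps rs pt rt v w : free [:: v; w] -> rs != rt ->
  ~ is_hyperplane (bisector ps rs pt rt).
Proof.
move=> vw rst [h [d [h0 BE]]].
have [u u0 hu] := free2_orthogonal h vw.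
apply: (@line_not_in_bisector ps rs pt rt (d / dotv h h *: h) u) => // t.
by rewrite BE /hyperplane /= !dotvE hu mulr0 addr0 divfK // dotv_eq0.
Qed.

Lemma enorm_sub_lt_sum ps pt x a : a < enorm (ps - pt) ->
  a < enorm (ps - x) + enorm (pt - x).
Proof.
move=> /lt_le_trans; apply; rewrite -(enormN (pt - x)) opprB.
by rewrite (le_trans _ (enorm_triangle _ _)) // addrA subrK.
Qed.

End Euclidean.

Theorem theorem17 (R : realType) (n : nat)
    (P : set 'rV[R]_n) (r : 'rV[R]_n -> R) (pj pk pl : 'rV[R]_n) :
  finite_set P ->
  (forall p, P p -> 0 <= r p) ->
  (forall ps pt, P ps -> P pt -> r pt < r ps ->
     r ps - r pt < enorm (ps - pt)) ->
  [set pj; pk; pl] `<=` P ->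
  affinely_independent [:: pj; pk; pl] ->
  r pk <= r pj -> r pl <= r pk -> r pl < r pj ->
  let Bjk := bisector pj (r pj) pk (r pk) in
  let Bjl := bisector pj (r pj) pl (r pl) in
  let Bkl := bisector pk (r pk) pl (r pl) in
  Bjk `&` Bjl `&` Bkl !=set0 ->
  exists (hT : 'rV[R]_n) (dT : R),
    let HT := hyperplane hT dT in
    [/\ hT != 0,
        [/\ inter_by HT Bjk Bjl, inter_by HT Bjk Bkl & inter_by HT Bjl Bkl]
      & forall B, [set Bjk; Bjl; Bkl] B -> is_hyperplane B -> B = HT].
Proof.
move=> _ _ rP TP indep rkj rlk rlj Bjk Bjl Bkl _.
have {}indep : free [:: pk - pj; pl - pj] := indep.
have Pj : P pj by apply: TP; left; left.
have Pk : P pk by apply: TP; left; right.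
pose a := r pj - r pl; pose b := r pj - r pk; pose c := r pk - r pl.
have a0 : 0 < a by rewrite subr_gt0.
have b0 : 0 <= b by rewrite subr_ge0.
have c0 : 0 <= c by rewrite subr_ge0.
have abc : a = b + c by rewrite /a /b /c; lra.
(* As [c = a - b], this is [2 (c pj + b pl - a pk)], written in the differences that are known to be
   free. *)
pose hT := 2 *: (b *: (pl - pj) - a *: (pk - pj)).
pose dT := c * dotv pj pj + b * dotv pl pl - a * dotv pk pk - a * b * c.
have HE x : hyperplane hT dT x <->
    c * enorm (pj - x) ^+ 2 + b * enorm (pl - x) ^+ 2 - a * enorm (pk - x) ^+ 2
    = a * b * c.
  rewrite /hyperplane /= !sqr_enorm /hT /dT !dotvE abc.
  by rewrite !(dotvC x); split; lra.
have ej0 x := enorm_ge0 (pj - x).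
have ek0 x := enorm_ge0 (pk - x).
have el0 x := enorm_ge0 (pl - x).
have BjkE x : Bjk x <-> enorm (pk - x) = enorm (pj - x) + b.
  by rewrite /Bjk /bisector /= /b; split; lra.
have BjlE x : Bjl x <-> enorm (pl - x) = enorm (pj - x) + a.
  by rewrite /Bjl /bisector /= /a; split; lra.
have BklE x : Bkl x <-> enorm (pl - x) = enorm (pk - x) + c.
  by rewrite /Bkl /bisector /= /c; split; lra.
have sq (y z : R) : 0 <= y -> 0 <= z -> y ^+ 2 = z ^+ 2 -> y = z.
  by move=> y0 z0 /eqP; rewrite eqrXn2 // => /eqP.
(* Here [a = c > 0], and the equation of the hyperplane reduces to [e_j ^ 2 = e_k ^ 2]. *)
have JK0 : b = 0 -> Bjk = hyperplane hT dT.
  move=> bE; apply/seteqP; split=> x; rewrite BjkE HE abc bE.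
    by rewrite addr0 => ->; ring.
  move=> Hx; rewrite addr0; apply: sq => //.
  have cn0 : c != 0 by move: a0; rewrite abc bE add0r; lra.
  by apply: (mulfI cn0); move: Hx; lra.
have KL0 : c = 0 -> Bkl = hyperplane hT dT.
  move=> cE; apply/seteqP; split=> x; rewrite BklE HE abc cE.
    by rewrite addr0 => ->; ring.
  move=> Hx; rewrite addr0; apply: sq => //.
  have bn0 : b != 0 by move: a0; rewrite abc cE addr0; lra.
  by apply: (mulfI bn0); move: Hx; lra.
(* Substituting [e_k = e_j + b] and dividing by [b] leaves [e_l ^ 2 = (e_j + a) ^ 2], whose bases
   are nonnegative. *)
have HJK x : b != 0 -> Bjk x -> hyperplane hT dT x -> Bjl x.
  rewrite BjkE HE BjlE => bn0 -> Hx; apply: sq => //.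
    by rewrite addr_ge0 // ltW.
  by apply: (mulfI bn0); move: Hx; rewrite abc; lra.
have HJL x : Bjl x -> hyperplane hT dT x -> Bjk x.
  rewrite BjkE HE BjlE => -> Hx; apply: sq => //; first by rewrite addr_ge0.
  by apply: (mulfI (lt0r_neq0 a0)); move: Hx; rewrite abc; lra.
have HKL x : c != 0 -> Bkl x -> hyperplane hT dT x -> Bjk x.
  rewrite BklE HE BjkE => cn0 -> Hx.
  have /eqP : enorm (pj - x) ^+ 2 = (enorm (pk - x) - b) ^+ 2.
    by apply: (mulfI cn0); move: Hx; rewrite abc; lra.
  rewrite eqf_sqr => /orP[] /eqP ejE; first by rewrite ejE; lra.
  (* For [b = 0] the second root is [e_j = - e_k], so both distances vanish and the claim holds. *)
  have [bE|bn0] := eqVneq b 0; first by have := ej0 x; have := ek0 x; lra.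
  have bgt0 : 0 < b by rewrite lt_neqAle eq_sym bn0.
  have /(enorm_sub_lt_sum x) : b < enorm (pj - pk).
    by apply: rP => //; rewrite -subr_gt0.
  lra.
have JKL x : Bjk x -> Bjl x -> hyperplane hT dT x.
  by rewrite BjkE BjlE HE abc => -> ->; ring.
(* Since [a = b + c], any two bisector equations imply the third; all three pairs thus have the same
   intersection. *)
have JK_JL x : Bjk x -> Bjl x -> Bkl x.
  by rewrite BjkE BjlE BklE abc; lra.
have JK_KL x : Bjk x -> Bkl x -> Bjl x.
  by rewrite BjkE BjlE BklE abc; lra.
have JL_KL x : Bjl x -> Bkl x -> Bjk x.
  by rewrite BjkE BjlE BklE abc; lra.
(* The exemption in [inter_by] enters here: it yields the nonzero coefficient by which [HJK] or
   [HKL] divides. *)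
have Jk : Bjk <> hyperplane hT dT -> b != 0.
  by move=> B; apply/eqP => /JK0.
have Kl : Bkl <> hyperplane hT dT -> c != 0.
  by move=> B; apply/eqP => /KL0.
exists hT, dT; split.
- rewrite scaler_eq0 pnatr_eq0 /=; apply: contra_neq (lt0r_neq0 a0).
  move=> /eqP; rewrite addrC -scaleNr => /eqP /(free2P indep) [+ _].
  by lra.
- split; split=> [B|B]; apply/seteqP; split=> x [].
  + by move=> Jkx Jlx; split=> //; apply: JKL.
  + by move=> Hx Jkx; split=> //; apply: HJK => //; apply: Jk.
  + by move=> Jkx Jlx; split=> //; apply: JKL.
  + by move=> Hx Jlx; split=> //; apply: HJL.
  + by move=> Jkx Klx; split=> //; apply: JKL => //; apply: JK_KL.
  + by move=> Hx Jkx; split=> //; apply: JK_JL => //; apply: HJK => //; apply: Jk.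
  + by move=> Jkx Klx; split=> //; apply: JKL => //; apply: JK_KL.
  + by move=> Hx Klx; split=> //; apply: HKL => //; apply: Kl.
  + by move=> Jlx Klx; split=> //; apply: JKL => //; apply: JL_KL.
  + by move=> Hx Jlx; split=> //; apply: JK_JL => //; apply: HJL.
  + by move=> Jlx Klx; split=> //; apply: JKL => //; apply: JL_KL.
  + move=> Hx Klx; split=> //; apply: JK_KL => //.
    by apply: HKL => //; apply: Kl.
(* A bisector that is a hyperplane has equal radii, which leaves the cases [b = 0] and [c = 0], as
   [a > 0] excludes [Bjl]. *)
- have neq (ps pt : 'rV[R]_n) (rs rt : R) : is_hyperplane (bisector ps rs pt rt) -> rs = rt.
    by apply: contraPeq; apply: bisector_not_hyperplane indep.
  move=> B [[]|] -> /neq rE; first by apply: JK0; rewrite /b rE subrr.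
    by rewrite rE ltxx in rlj.
  by apply: KL0; rewrite /c rE subrr.
Qed.
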